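(* For an integer $n\ge 3$ let $R(n)$ be the largest cardinality of a family $\mathcal{G}$ of graphs on the vertex set $[n]=\{1,\dots,n\}$, each having all vertex degrees equal to $2$, such that the union of any two different members of $\mathcal{G}$ has maximum degree at least $4$. Then there is an absolute constant $c>0$ such that for every $n\ge 3$ $$ c\cdot \frac{n!}{\lfloor n/3 \rfloor !\;6^{n/3}} \leq R(n)\leq e^{\sqrt{n}}\,\frac{n!}{\lfloor n/3 \rfloor !}.$$ Moreover, if $n$ is a multiple of $3$, the lower bound holds with the constant equal to $1$, that is, $R(n)\ge \frac{n!}{\lfloor n/3 \rfloor !\;6^{n/3}}$.
   Context: All graphs are finite, simple and undirected, with labelled vertex set $[n]=\{1,2,\dots,n\}$; they are not required to be connected. Two graphs on $[n]$ are different if their edge sets are different. The union of two graphs on the same vertex set $[n]$ is the graph on $[n]$ whose edge set is the union of the two edge sets. A graph has maximum degree at least $4$ if some vertex has degree at least $4$ (for the union of two graphs with all degrees $2$ this is the same as maximum degree exactly $4$). *)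

(* Defs.v *)
From mathcomp Require Import all_boot.
Set Implicit Arguments.
Unset Strict Implicit.
Unset Printing Implicit Defensive.

(* The vertex set [n] = {1, ..., n} is represented by 'I_n = {0, ..., n-1}.   *)
(* A simple graph on it is its edge set, a set of two-element sets of         *)
(* vertices; hence two graphs are equal exactly when their edge sets are, and *)
(* the union of the graphs E and F is E :|: F.                                *)
Definition simple_graph (n : nat) (E : {set {set 'I_n}}) : bool :=
  [forall e in E, #|e| == 2].

Definition degree (n : nat) (E : {set {set 'I_n}}) (v : 'I_n) : nat :=
  #|[set e in E | v \in e]|.

Definition two_regular (n : nat) (E : {set {set 'I_n}}) : bool :=
  [forall v, degree E v == 2].

Definition maxdeg_ge (k n : nat) (E : {set {set 'I_n}}) : bool :=
  [exists v, k <= degree E v].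

Definition admissible (n : nat) (G : {set {set {set 'I_n}}}) : bool :=
  [forall E in G, simple_graph E && two_regular E] &&
  [forall E in G, forall F in G, (E != F) ==> maxdeg_ge 4 (E :|: F)].

(* The maximum is attained, since the empty family is admissible.             *)
Definition max_family (n : nat) : nat :=
  \max_(G : {set {set {set 'I_n}}} | admissible G) #|G|.

(* Main.v *)
Require Import Defs.
From HB Require Import structures.
From mathcomp Require Import all_boot all_order all_algebra.
From mathcomp Require Import reals.
From mathcomp.analysis Require Import sequences exp.
From mathcomp Require Import zify.
Import Order.TTheory GRing.Theory Num.Theory.

(** Two members of an admissible family must have, at some vertex v, no common
    edge; and this is also sufficient, because the union of two 2-regular
    graphs has degree 4 at v exactly when their edges at v are disjoint.

    Upper bound. A minimal edge cover of a 2-regular graph is a disjoint union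
    of single edges and paths with two edges (cherries). If two members of the
    family had the same such cover, they would share an edge at every vertex;
    so the choice of a minimal edge cover in each member is injective
    ([edge_cover_packing]). The number of ways to place j disjoint edges and
    cherries on n vertices is at most n!/j! ([card_star_packings]), because
    removing one of them gives a recursion in which edges and cherries
    contribute at most n!/2 each. A cover has between n/3 and n/2 components,
    whence R(n) <= (n/2 + 1) n!/(n/3)!, and n/2 + 1 <= exp (sqrt n).

    Lower bound. Write n = 3m + r with r < 3. Mark r vertices, and choose m - r
    disjoint triples among the other 3m. The 3r unused vertices are split
    arbitrarily into one triple for each marked vertex, which together with
    that vertex forms a class of size 4. Running a cycle through every triple
    and every class of size 4 gives a 2-regular graph. If two choices differ,
    some triple T of the first is not in the second. Either some vertex of T is
    separated from the rest of T by the second partition, and there the two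
    graphs have no common neighbour; or T lies in a class of the second
    partition, hence is the triple given there to some marked vertex w. In the
    latter case the class of w in the first partition avoids T, so that w has
    no common neighbour ([extensions_separated]). Counting the choices
    ([card_triple_packings]) gives n!/((n/3)! 6^(n/3)) exactly for r = 0, and a
    constant fraction of it for r = 1, 2. *)

Set Implicit Arguments.
Unset Strict Implicit.
Unset Printing Implicit Defensive.

(** * Packings of blocks with disjoint supports *)

(** The elements of B are blocks placed on the set [sup b] of vertices; only the
    blocks in A may be used. Packings that leave vertices of S free are included, so
    that k = 0 is the only base case of the recursion below. *)
Definition packings (V B : finType) (sup : B -> {set V}) (A : {set B})
    (S : {set V}) (k : nat) : {set {set B}} :=
  [set P : {set B} | [&& P \subset A, #|P| == k,
     [forall b in P, sup b \subset S] &
     [forall b in P, forall b' in P,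
        (b != b') ==> [disjoint sup b & sup b']]]].

Lemma packingsP (V B : finType) (sup : B -> {set V}) (A : {set B})
    (S : {set V}) (k : nat) (P : {set B}) :
  reflect [/\ P \subset A, #|P| = k, forall b, b \in P -> sup b \subset S &
     forall b b', b \in P -> b' \in P -> b != b' ->
       [disjoint sup b & sup b']]
    (P \in packings sup A S k).
Proof.
rewrite inE; apply: (iffP and4P) => [[sPA /eqP cP /forall_inP sS dP]|].
  split=> // b b' bP b'P.
  by move/forall_inP: dP => /(_ b bP) /forall_inP/(_ b' b'P)/implyP.
case=> sPA cP sS dP; split=> //; [exact/eqP | exact/forall_inP | ].
by apply/forall_inP=> b bP; apply/forall_inP=> b' b'P; apply/implyP; apply: dP.
Qed.

(** Deleting b is a bijection onto the smaller packings, with inverse adding b: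
    since [sup b] is not empty, b cannot already belong to a packing of the
    vertices outside [sup b]. *)
Lemma packings_with (V B : finType) (sup : B -> {set V}) (A : {set B})
    (S : {set V}) (k : nat) (b : B) :
  b \in A -> sup b != set0 -> sup b \subset S ->
  #|[set P in packings sup A S k.+1 | b \in P]|
    = #|packings sup A (S :\: sup b) k|.
Proof.
move=> bA nb sbS.
have notb P : P \in packings sup A (S :\: sup b) k -> b \notin P.
  move=> /packingsP[_ _ sS _]; apply/negP => /sS.
  rewrite subsetD => /andP[_]; rewrite -setI_eq0 setIid.
  by rewrite (negPf nb).
rewrite -[RHS](@card_in_imset _ _ (fun P => b |: P)); last first.
  by move=> P Q /notb nP /notb nQ eqPQ; rewrite -(setU1K nP) eqPQ setU1K.
apply: eq_card => P; apply/idP/imsetP; last first.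
  case=> Q QP ->; have bQ := notb _ QP; case/packingsP: QP => sA cQ sS dQ.
  have dbQ b' : b' \in Q -> [disjoint sup b & sup b'].
    by move/sS; rewrite subsetD disjoint_sym => /andP[].
  rewrite inE setU11 andbT; apply/packingsP.
  split.
  - by rewrite subUset sub1set bA.
  - by rewrite cardsU1 bQ cQ.
  - move=> b'; rewrite !inE => /orP[/eqP -> //|/sS].
    by rewrite subsetD => /andP[].
  - move=> b1 b2; rewrite !inE => /orP[/eqP ->|b1Q] /orP[/eqP ->|b2Q].
    + by rewrite eqxx.
    + by move=> _; apply: dbQ.
    + by move=> _; rewrite disjoint_sym; apply: dbQ.
    + exact: dQ.
rewrite inE => /andP[/packingsP[sA cP sS dP] bP].
exists (P :\ b); last by rewrite setD1K.
apply/packingsP; split.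
- by apply: subset_trans sA; apply: subD1set.
- by have := cardsD1 b P; rewrite bP cP add1n => -[].
- move=> b'; rewrite !inE => /andP[nb' b'P]; rewrite subsetD sS //=.
  by apply: dP.
- by move=> b1 b2; rewrite !inE => /andP[_ b1P] /andP[_ b2P]; apply: dP.
Qed.

(** Double counting of the pairs formed by a packing and one of its blocks. This
    recursion drives both the exact count of triples and the upper estimate for
    stars. *)
Lemma packings_rec (V B : finType) (sup : B -> {set V}) (A : {set B})
    (S : {set V}) (k : nat) :
  (forall b, b \in A -> sup b != set0) ->
  k.+1 * #|packings sup A S k.+1|
    = \sum_(b in A | sup b \subset S) #|packings sup A (S :\: sup b) k|.
Proof.
move=> n0.
transitivity (\sum_(P in packings sup A S k.+1) \sum_(b in P) 1).
  rewrite mulnC -sum_nat_const; apply: eq_bigr => P /packingsP[_ cP _ _].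
  by rewrite sum1_card.
rewrite (exchange_big_dep (fun b => (b \in A) && (sup b \subset S))) /=; last first.
  by move=> P b /packingsP[/subsetP sA _ sS _] bP; rewrite sA ?sS.
apply: eq_bigr => b /andP[bA bS].
rewrite -(packings_with k bA (n0 b bA) bS) -sum1_card.
by apply: eq_bigl => P; rewrite !inE.
Qed.

Lemma packings0 (V B : finType) (sup : B -> {set V}) (A : {set B})
    (S : {set V}) :
  packings sup A S 0 = [set set0].
Proof.
apply/setP=> P; apply/packingsP/set1P => [[_ P0 _ _]|->].
  exact: cards0_eq.
by split; rewrite ?sub0set ?cards0 // => b; rewrite inE.
Qed.

Lemma card_bigcup_leq (V I : finType) (r : seq I) (Q : pred I)
    (F : I -> {set V}) :
  #|\bigcup_(i <- r | Q i) F i| <= \sum_(i <- r | Q i) #|F i|.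
Proof.
elim: r => [|i r IH]; first by rewrite !big_nil cards0.
rewrite !big_cons; case: ifP => // _.
by rewrite cardsU; apply: leq_trans (leq_subr _ _) _; rewrite leq_add2l.
Qed.

Lemma card_packing_cover (V B : finType) (sup : B -> {set V}) (A : {set B})
    (S : {set V}) (k : nat) (P : {set B}) :
  P \in packings sup A S k ->
  #|\bigcup_(b in P) sup b| = \sum_(b in P) #|sup b|.
Proof.
case/packingsP=> _ _ _ dP; rewrite [in LHS]big_mkcond -sum1_card /=.
rewrite partition_disjoint_bigcup /=.
  rewrite [RHS]big_mkcond; apply: eq_bigr => b _.
  by rewrite sum1_card; case: ifP; rewrite ?cards0.
move=> b b' nbb'; case: ifP => bP; last by rewrite disjoints_subset sub0set.
case: ifP => b'P; last by rewrite disjoint_sym disjoints_subset sub0set.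
exact: dP.
Qed.

(** * Packings of triples *)

Definition triples (V : finType) : {set {set V}} := [set T : {set V} | #|T| == 3].

(** Every ordering of S arises once from a packing together with orderings of
    its k triples, of the vertices inside each, and of the unused vertices. *)
Lemma card_triple_packings (V : finType) (S : {set V}) (k : nat) :
  3 * k <= #|S| ->
  #|packings id (triples V) S k| * (k`! * 6 ^ k * (#|S| - 3 * k)`!) = #|S|`!.
Proof.
elim: k S => [|k IH] S kS.
  by rewrite packings0 cards1 muln0 subn0 expn0 fact0 !mul1n.
have n0 (T : {set V}) : T \in triples V -> T != set0.
  by rewrite inE -cards_eq0 => /eqP ->.
have := packings_rec S k n0; set N := #|_| => EN.
have {}EN : (k.+1 * N) * (k`! * 6 ^ k * (#|S| - 3 * k.+1)`!)
            = 'C(#|S|, 3) * (#|S| - 3)`!.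
  rewrite EN big_distrl /=.
  rewrite -cards_draws -sum_nat_const.
  apply: eq_big => [T|T]; first by rewrite !inE andbC.
  rewrite inE => /andP[/eqP cT sT].
  have cST : #|S :\: T| = #|S| - 3.
    by rewrite cardsD (setIidPr sT) cT.
  have kST : 3 * k <= #|S :\: T| by rewrite cST; lia.
  have -> : #|S| - 3 * k.+1 = #|S :\: T| - 3 * k by rewrite cST; lia.
  by rewrite IH // cST.
have S3 : 3 <= #|S| by lia.
have := bin_fact S3; rewrite (_ : 3`! = 6) => [<-|//].
rewrite factS expnS.
transitivity (6 * ((k.+1 * N) * (k`! * 6 ^ k * (#|S| - 3 * k.+1)`!))).
  lia.
rewrite EN; lia.
Qed.

(** * Packings of edges and cherries *)

Definition star (V : finType) (v : V) (L : {set V}) : {set {set V}} :=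
  [set [set v; x] | x in L].

Definition edge_blocks (V : finType) : {set {set {set V}}} :=
  [set [set e] | e in [set e : {set V} | #|e| == 2]].

Definition cherry_blocks (V : finType) : {set {set {set V}}} :=
  \bigcup_v [set star v L | L in [set L : {set V} | L \subset ~: [set v] & #|L| == 2]].

(** The possible connected components of a minimal edge cover of a graph of
    maximum degree 2, each given by its edge set. *)
Definition small_stars (V : finType) : {set {set {set V}}} :=
  edge_blocks V :|: cherry_blocks V.

Lemma cover_set1 (V : finType) (e : {set V}) : cover [set e] = e.
Proof. by rewrite /cover big_set1. Qed.

Lemma cover_star (V : finType) (v : V) (L : {set V}) :
  L != set0 -> cover (star v L) = v |: L.
Proof.
case/set0Pn=> y yL; apply/setP=> x; apply/bigcupP/setU1P.
  by case=> e /imsetP[z zL ->] /set2P[->|->]; auto.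
case=> [->|xL].
  by exists [set v; y]; [apply: (imset_f (fun z => [set v; z])) | rewrite set21].
by exists [set v; x]; [apply: (imset_f (fun z => [set v; z])) | rewrite set22].
Qed.

Lemma card_edge_blocks_in (V : finType) (S : {set V}) :
  #|[set D in edge_blocks V | cover D \subset S]| <= 'C(#|S|, 2).
Proof.
rewrite -cards_draws; apply: leq_trans (leq_imset_card (@set1 _) _).
apply: subset_leq_card; apply/subsetP=> D.
rewrite inE => /andP[/imsetP[e]]; rewrite inE => ce ->.
by rewrite cover_set1 => eS; apply: imset_f; rewrite inE eS.
Qed.

Lemma card_cherry_blocks_in (V : finType) (S : {set V}) :
  #|[set D in cherry_blocks V | cover D \subset S]| <= #|S| * 'C(#|S|.-1, 2).
Proof.
pose L_ v := [set L : {set V} | L \subset S :\ v & #|L| == 2].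
apply: (@leq_trans #|\bigcup_(v in S) [set star v L | L in L_ v]|).
  apply: subset_leq_card; apply/subsetP=> D; rewrite inE.
  case/andP=> /bigcupP[v _ /imsetP[L]]; rewrite inE => /andP[Lv cL] ->.
  have nL : L != set0 by rewrite -cards_eq0 (eqP cL).
  rewrite cover_star // subUset sub1set => /andP[vS LS].
  apply/bigcupP; exists v => //; apply: imset_f; rewrite inE cL andbT.
  by rewrite setDE subsetI LS.
apply: leq_trans (card_bigcup_leq _ _ _) _; rewrite -sum_nat_const.
apply: leq_sum => v vS; apply: leq_trans (leq_imset_card _ _) _.
rewrite cards_draws; have := cardsD1 v S; rewrite vS => ->.
by rewrite add1n.
Qed.

Lemma card_cover_edge_block (V : finType) (D : {set {set V}}) :
  D \in edge_blocks V -> #|cover D| = 2.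
Proof. by case/imsetP=> e; rewrite inE => /eqP ce ->; rewrite cover_set1. Qed.

Lemma card_cover_cherry_block (V : finType) (D : {set {set V}}) :
  D \in cherry_blocks V -> #|cover D| = 3.
Proof.
case/bigcupP=> v _ /imsetP[L]; rewrite inE => /andP[Lv /eqP cL] ->.
rewrite cover_star -?cards_eq0 ?cL // cardsU1 cL.
by have -> : v \notin L by rewrite -disjoints1 disjoint_sym disjoints_subset.
Qed.

Lemma card_cover_small_star (V : finType) (D : {set {set V}}) :
  D \in small_stars V -> 2 <= #|cover D| <= 3.
Proof.
by rewrite inE => /orP[/card_cover_edge_block|/card_cover_cherry_block] ->.
Qed.

(** With s = #|S|, there are at most s(s-1)/2 edges in S, each leaving s-2
    vertices, and s(s-1)(s-2)/2 cherries, each leaving s-3; by induction the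
    right side of the recursion is at most s!/2 + s!/2. *)
Lemma card_star_packings (V : finType) (S : {set V}) (k : nat) :
  k`! * #|packings cover (small_stars V) S k| <= #|S|`!.
Proof.
elim: k S => [|k IH] S.
  by rewrite packings0 cards1 fact0 fact_gt0.
have cE := @card_cover_edge_block V; have cC := @card_cover_cherry_block V.
rewrite factS -mulnA mulnCA packings_rec; last first.
  by move=> D; rewrite -cards_eq0 inE => /orP[/cE|/cC] ->.
rewrite big_distrr /=.
apply: (@leq_trans (\sum_(D in small_stars V | cover D \subset S)
                      (#|S| - #|cover D|)`!)).
  apply: leq_sum => D /andP[_ DS].
  by apply: leq_trans (IH _) _; rewrite cardsD (setIidPr DS).
pose E := [set D in edge_blocks V | cover D \subset S].
pose C := [set D in cherry_blocks V | cover D \subset S].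
have EP D : D \in E -> #|cover D| = 2 by rewrite inE => /andP[/cE].
have CP D : D \in C -> #|cover D| = 3 by rewrite inE => /andP[/cC].
apply: (@leq_trans (\sum_(D in E) (#|S| - 2)`! + \sum_(D in C) (#|S| - 3)`!)).
  rewrite (bigID (mem E)) /=; apply: leq_add.
    rewrite (eq_bigl (mem E)); last first.
      move=> D; rewrite !inE.
      by case: (D \in edge_blocks V); case: (cover D \subset S); rewrite ?andbF.
    by apply: leq_sum => D DE; rewrite EP.
  rewrite [leqRHS](bigID (mem E)) /=; apply: leq_trans (leq_addl _ _).
  rewrite [leqLHS](eq_bigl (fun D => (D \in C) && (D \notin E))); last first.
    move=> D; rewrite !inE.
    by case: (D \in edge_blocks V); case: (cover D \subset S); rewrite ?andbF.
  by apply: leq_sum => D /andP[DC _]; rewrite CP.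
rewrite !sum_nat_const.
have E2 : #|E| * (#|S| - 2)`! * 2 <= #|S|`!.
  case: (ltnP #|S| 2) => S2.
    have := card_edge_blocks_in S; rewrite bin_small // leqn0 => /eqP.
    by rewrite -/E => ->.
  rewrite -(bin_fact S2) (_ : 2`! = 2) //; have := card_edge_blocks_in S; rewrite -/E; nia.
have C2 : #|C| * (#|S| - 3)`! * 2 <= #|S|`!.
  have := card_cherry_blocks_in S; rewrite -/C.
  case: (ltnP #|S| 3) => S3.
    rewrite bin_small; last by lia.
    by rewrite muln0 leqn0 => /eqP ->.
  have S2 : 2 <= #|S|.-1 by lia.
  have <- : #|S| * #|S|.-1`! = #|S|`! by case: #|S| S3 => // s _; rewrite factS.
  rewrite -(bin_fact S2) (_ : 2`! = 2) //; have -> : #|S|.-1 - 2 = #|S| - 3 by lia.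
  nia.
lia.
Qed.

(** * Minimal edge covers *)

Definition edges_at (V : finType) (E : {set {set V}}) (v : V) : {set {set V}} :=
  [set e in E | v \in e].

Lemma edges_atU (V : finType) (E F : {set {set V}}) (v : V) :
  edges_at (E :|: F) v = edges_at E v :|: edges_at F v.
Proof. by apply/setP=> e; rewrite !inE andb_orl. Qed.

Lemma other_end (V : finType) (e : {set V}) (v : V) :
  #|e| = 2 -> v \in e -> exists2 w, w != v & e = [set v; w].
Proof.
move/eqP/cards2P=> [x [y [nxy ->]]] /set2P[->|->].
  by exists y; rewrite // eq_sym.
by exists x; rewrite // setUC.
Qed.

Section MinimalEdgeCover.

Variables (V : finType) (E C : {set {set V}}).
Hypothesis simpleE : forall e, e \in E -> #|e| = 2.
Hypothesis maxdeg2 : forall v, #|edges_at E v| <= 2.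
Hypothesis minC :
  minset (fun C' : {set {set V}} => (C' \subset E) && (cover C' == setT)) C.

Let subCE : C \subset E. Proof. by case/andP: (minsetp minC). Qed.

Let in_edge v : exists2 e, e \in C & v \in e.
Proof.
case/andP: (minsetp minC) => _ /eqP cC.
have : v \in cover C by rewrite cC inE.
by case/bigcupP=> e; exists e.
Qed.

Let card_edge e : e \in C -> #|e| = 2.
Proof. by move/(subsetP subCE)/simpleE. Qed.

(** Otherwise every vertex of e would still be covered after the removal of e,
    against minimality. *)
Lemma minimal_cover_leaf e :
  e \in C -> exists2 v, v \in e & edges_at C v = [set e].
Proof.
move=> eC.
have [/exists_inP[v ve /eqP]|] := boolP [exists v in e, edges_at C v == [set e]].
  by exists v.
rewrite negb_exists_in => /forall_inP noleaf.
suff eqC : C :\ e = C by have := setD11 e C; rewrite eqC eC.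
apply: (minsetinf minC); last exact: subD1set.
rewrite (subset_trans (subD1set _ _) subCE) /=; apply/eqP/setP=> x.
rewrite inE; apply/bigcupP; have [xe|xe] := boolP (x \in e); last first.
  have [f fC xf] := in_edge x; exists f => //; rewrite !inE fC andbT.
  by apply: contraNneq xe => <-.
have [/existsP[f]|] := boolP [exists f, (f \in C) && (x \in f) && (f != e)].
  by case/andP=> /andP[fC xf] nfe; exists f; rewrite // !inE nfe.
rewrite negb_exists => /forallP only; case/negP: (noleaf x xe).
apply/eqP/setP=> f; rewrite !inE; apply/idP/eqP => [fCx|->]; last by rewrite eC.
by have := only f; rewrite fCx /= => /negPn/eqP.
Qed.

(** One step of adjacency already gives the whole connected component, since one
    end of every edge is a leaf. *)
Definition component (e : {set V}) : {set {set V}} :=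
  \bigcup_(v in e) edges_at C v.

Lemma mem_component e : e \in C -> e \in component e.
Proof.
move=> eC; have [v ve _] := minimal_cover_leaf eC.
by apply/bigcupP; exists v; rewrite // inE eC.
Qed.

Lemma component_star e :
  e \in C -> exists2 c, c \in e & component e = edges_at C c.
Proof.
move=> eC; have [v ve leaf] := minimal_cover_leaf eC.
have [c nc def_e] := other_end (card_edge eC) ve.
have ce : c \in e by rewrite def_e set22.
exists c => //; rewrite /component {1}def_e big_setU1 ?inE 1?eq_sym //= big_set1.
by rewrite leaf; apply/setUidPr; rewrite sub1set inE eC.
Qed.

(** The star of its centre c is the component of each of its edges f. Indeed f
    has a leaf; if that leaf is c then f is the only edge of the star, and
    otherwise the star of the other end of f, which is c, is added. *)
Lemma component_same e f :
  e \in C -> f \in component e -> component f = component e.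
Proof.
move=> eC; have [c ce def_comp] := component_star eC.
rewrite def_comp inE => /andP[fC cf]; have [v vf leaf] := minimal_cover_leaf fC.
have [eqvc|nvc] := eqVneq v c.
  have : e \in edges_at C v by rewrite inE eC eqvc.
  by rewrite leaf -def_comp => /set1P ->.
have [c' nc' def_f] := other_end (card_edge fC) vf.
have eqcc' : c' = c by move: cf; rewrite def_f => /set2P[/esym/eqP|//]; rewrite (negPf nvc).
rewrite /component {1}def_f big_setU1 ?inE 1?eq_sym //= big_set1.
by rewrite leaf eqcc'; apply/setUidPr; rewrite sub1set inE fC.
Qed.

Lemma component_meet e f x : e \in C -> f \in C ->
  x \in cover (component e) -> x \in cover (component f) ->
  component e = component f.
Proof.
move=> eC fC /bigcupP[e' e'D xe'] /bigcupP[f' f'D xf'].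
have inC g g' : g \in C -> g' \in component g -> g' \in C.
  by move=> gC /bigcupP[y _]; rewrite inE => /andP[].
rewrite -(component_same eC e'D) -(component_same fC f'D).
have e'C := inC _ _ eC e'D; apply/esym/component_same => //.
by apply/bigcupP; exists x; rewrite // inE xf' (inC _ _ fC f'D).
Qed.

Lemma component_small_star e : e \in C -> component e \in small_stars V.
Proof.
move=> eC; have [c ce def_comp] := component_star eC.
have e_at : e \in edges_at C c by rewrite inE eC.
have : #|edges_at C c| <= 2.
  apply: leq_trans (subset_leq_card _) (maxdeg2 c).
  by apply/subsetP=> f; rewrite !inE => /andP[/(subsetP subCE) ->].
rewrite leq_eqVlt def_comp inE => /orP[/cards2P[f [g [nfg def_at]]]|le1].
  apply/orP; right; have [fC cf] : f \in C /\ c \in f.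
    have : f \in edges_at C c by rewrite def_at set21.
    by rewrite inE => /andP.
  have [gC cg] : g \in C /\ c \in g.
    have : g \in edges_at C c by rewrite def_at set22.
    by rewrite inE => /andP.
  have [x nxc def_f] := other_end (card_edge fC) cf.
  have [y nyc def_g] := other_end (card_edge gC) cg.
  have nxy : x != y by apply: contraNneq nfg => eqxy; rewrite def_f def_g eqxy.
  apply/bigcupP; exists c => //; apply/imsetP; exists [set x; y].
    rewrite inE cards2 nxy subUset !sub1set !inE nxc nyc //.
  by rewrite def_at /star imsetU1 imset_set1 -def_f -def_g.
apply/orP; left; apply/imsetP; exists e; first by rewrite inE card_edge.
apply/esym/eqP; rewrite eqEcard sub1set e_at cards1; exact: le1.
Qed.

End MinimalEdgeCover.

(** The packing consists of the components of a minimal edge cover of E. *)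
Lemma edge_cover_packing (V : finType) (E : {set {set V}}) :
  (forall e, e \in E -> #|e| = 2) -> (forall v, 0 < #|edges_at E v| <= 2) ->
  exists P : {set {set {set V}}}, [/\ P \in packings cover (small_stars V) setT #|P|,
    cover P \subset E & cover (cover P) = setT].
Proof.
move=> simpleE degE; have maxdeg2 v : #|edges_at E v| <= 2 by case/andP: (degE v).
pose covers (C : {set {set V}}) := (C \subset E) && (cover C == setT).
have coversE : covers E.
  rewrite /covers subxx; apply/eqP/setP=> v; rewrite inE; apply/bigcupP.
  case/andP: (degE v) => /card_gt0P[e]; rewrite inE => /andP[eE ve] _.
  by exists e.
have [C minC _] := minset_exists coversE.
have /andP[sCE /eqP covC] := minsetp minC.
exists (component C @: C); split.
- apply/packingsP; split=> // [|D D' /imsetP[e eC ->] /imsetP[f fC ->]].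
  + apply/subsetP=> _ /imsetP[e eC ->].
    exact: (component_small_star simpleE maxdeg2 minC).
  + rewrite -setI_eq0; apply: contraNT => /set0Pn[x /setIP[xe xf]].
    by apply/eqP; apply: (component_meet simpleE minC eC fC xe xf).
- apply/subsetP=> f /bigcupP[_ /imsetP[e _ ->] /bigcupP[v _]].
  by rewrite inE => /andP[/(subsetP sCE)].
- apply/eqP; rewrite -subTset -covC; apply/subsetP=> v /bigcupP[e eC ve].
  apply/bigcupP; exists e => //; apply/bigcupP; exists (component C e).
    exact: imset_f.
  exact: (mem_component minC).
Qed.

(** * The upper bound *)

Lemma star_packing_size (V : finType) (P : {set {set {set V}}}) :
  P \in packings cover (small_stars V) setT #|P| -> cover (cover P) = setT ->
  2 * #|P| <= #|V| <= 3 * #|P|.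
Proof.
move=> packP covP; have /packingsP[sP _ _ _] := packP.
have -> : #|V| = \sum_(D in P) #|cover D|.
  rewrite -(card_packing_cover packP) -cardsT -covP; congr #|pred_of_set _|.
  apply/setP=> v; apply/bigcupP/bigcupP.
    by case=> e /bigcupP[D DP eD] ve; exists D => //; apply/bigcupP; exists e.
  by case=> D DP /bigcupP[e eD ve]; exists e => //; apply/bigcupP; exists D.
rewrite ![_ * #|P|]mulnC -!sum_nat_const; apply/andP; split;
  by apply: leq_sum => D /(subsetP sP)/card_cover_small_star/andP[].
Qed.

Lemma degree_setU_common_edge (n : nat) (E F : {set {set 'I_n}}) e v :
  two_regular E -> two_regular F -> e \in E -> e \in F -> v \in e ->
  degree (E :|: F) v <= 3.
Proof.
move=> /forallP/(_ v)/eqP dE /forallP/(_ v)/eqP dF eE eF ve.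
rewrite /degree -/(edges_at _ v) edges_atU cardsU.
rewrite /degree -/(edges_at _ v) in dE; rewrite /degree -/(edges_at _ v) in dF.
rewrite dE dF; have : 0 < #|edges_at E v :&: edges_at F v|.
  by apply/card_gt0P; exists e; rewrite !inE eE eF ve.
lia.
Qed.

(** A packing with k stars that covers all n vertices satisfies
    2 k <= n <= 3 k, so only the [n./2 + 1] values of k up to [n./2] occur, and
    for each of them [k`!] can be replaced by the smaller [(n %/ 3)`!]. *)
Lemma max_family_upper (n : nat) :
  (n %/ 3)`! * max_family n <= (n./2).+1 * n`!.
Proof.
suff le_adm (G : {set {set {set 'I_n}}}) : admissible G ->
    (n %/ 3)`! * #|G| <= (n./2).+1 * n`!.
  rewrite /max_family; elim/big_ind: _ => [|x y Hx Hy|G].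
  - by rewrite muln0.
  - by case: (leqP x y).
  - exact: le_adm.
case/andP=> /forall_inP regG /forall_inP doubG.
have /fin_all_exists[packing packingE] : forall E : {set {set 'I_n}},
    exists P : {set {set {set 'I_n}}}, E \in G ->
    [/\ P \in packings cover (small_stars 'I_n) setT #|P|,
      cover P \subset E & cover (cover P) = setT].
  move=> E; have [EG|_] := boolP (E \in G); last by exists set0.
  have /andP[/forall_inP sE /forallP dE] := regG E EG.
  have [||P packP] := @edge_cover_packing _ E; last by exists P.
    by move=> e /sE/eqP.
  by move=> v; move: (dE v); rewrite /degree -/(edges_at E v) => /eqP ->.
(* A common edge at every vertex would contradict maximum degree 4. *)
have inj_packing : {in G &, injective packing}.
  move=> E F EG FG eqP_EF; apply/eqP; apply: contraT => nEF.
  have /andP[_ regE] := regG E EG; have /andP[_ regF] := regG F FG.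
  have /forall_inP/(_ F FG) := doubG E EG; rewrite nEF => /existsP[v].
  have [_ sPE covP] := packingE E EG; have [_ sPF _] := packingE F FG.
  have : v \in cover (cover (packing E)) by rewrite covP inE.
  case/bigcupP=> e eP ve; have eE := subsetP sPE e eP.
  have eF : e \in F by apply: (subsetP sPF); rewrite -eqP_EF.
  by move/leq_trans/(_ (degree_setU_common_edge regE regF eE eF ve)).
rewrite -(card_in_imset inj_packing).
apply: (@leq_trans ((n %/ 3)`! *
    #|\bigcup_(k < (n./2).+1 | n %/ 3 <= k)
       packings cover (small_stars 'I_n) setT k|)).
  rewrite leq_mul2l; apply/orP; right; apply: subset_leq_card.
  apply/subsetP=> _ /imsetP[E EG ->]; have [packP _ covP] := packingE E EG.
  have := star_packing_size packP covP; rewrite card_ord => /andP[le2 le3].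
  have lt_k : #|packing E| < (n./2).+1 by lia.
  apply/bigcupP; exists (Ordinal lt_k); last exact: packP.
  by have := leq_div2r 3 le3; rewrite mulKn.
apply: leq_trans (leq_mul (leqnn _) (card_bigcup_leq _ _ _)) _.
rewrite big_distrr /= -[in leqRHS](card_ord (n./2).+1) -sum_nat_const.
rewrite [leqRHS](bigID (fun k : 'I_(n./2).+1 => n %/ 3 <= k)) /=.
apply: leq_trans (leq_addr _ _); apply: leq_sum => k le_k.
have := card_star_packings [set: 'I_n] k; rewrite cardsT card_ord.
by apply: leq_trans; rewrite leq_mul2r leq_fact // orbT.
Qed.

(** * Graphs made of cycles through colour classes *)

Lemma next_neq (T : eqType) (p : seq T) (x : T) :
  uniq p -> 2 < size p -> x \in p ->
  (next p x != x) && (next p (next p x) != x).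
Proof.
move=> up sp /rot_to[i q def_p].
rewrite -!(next_rot i up) def_p.
have : uniq (x :: q) by rewrite -def_p rot_uniq.
have : 2 < size (x :: q) by rewrite -def_p size_rot.
case: q {def_p} => [|y [|z q]] //= _; rewrite !inE !negb_or.
case/and3P=> /and3P[nxy nxz _] _ _.
by rewrite !eqxx !(eq_sym _ x) (negPf nxy) (negPf nxz).
Qed.

Definition colour_class (V : finType) (K : eqType) (c : V -> K) (v : V) : {set V} :=
  [set u | c u == c v].

(** Any cyclic order of the colour class would serve; that of its enumeration is
    at hand. *)
Definition class_next (V : finType) (K : eqType) (c : V -> K) (v : V) : V :=
  next (enum (colour_class c v)) v.

Definition cycle_graph (V : finType) (K : eqType) (c : V -> K) : {set {set V}} :=
  [set [set v; class_next c v] | v : V].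

Section CycleGraph.

Variables (V : finType) (K : eqType) (c : V -> K).
Hypothesis large_classes : forall v, 3 <= #|colour_class c v|.

Let colour_next v : c (class_next c v) = c v.
Proof.
have : class_next c v \in enum (colour_class c v).
  by rewrite mem_next mem_enum inE.
by rewrite mem_enum inE => /eqP.
Qed.

Let next_inj : injective (class_next c).
Proof.
move=> u v eq_next.
have eqc : c u = c v by rewrite -(colour_next u) eq_next colour_next.
have eqC : colour_class c u = colour_class c v.
  by apply/setP=> x; rewrite !inE eqc.
move: eq_next; rewrite /class_next eqC.
exact: (can_inj (prev_next (enum_uniq _))).
Qed.

Let next_neqs v :
  (class_next c v != v) && (class_next c (class_next c v) != v).
Proof.
have eqC : colour_class c (class_next c v) = colour_class c v.
  by apply/setP=> x; rewrite !inE colour_next.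
rewrite {2}/class_next eqC; apply: next_neq; rewrite ?enum_uniq //.
  by rewrite -cardE.
by rewrite mem_enum inE.
Qed.

Lemma card_cycle_graph_edge e : e \in cycle_graph c -> #|e| = 2.
Proof.
by case/imsetP=> v _ ->; rewrite cards2 eq_sym; case/andP: (next_neqs v) => ->.
Qed.

Lemma cycle_graph_edge_sub e v :
  e \in cycle_graph c -> v \in e -> e \subset colour_class c v.
Proof.
case/imsetP=> u _ -> uv; rewrite subUset !sub1set 2!inE colour_next.
rewrite andbb; move: uv => /set2P[->|->]; by rewrite ?colour_next.
Qed.

Lemma card_cycle_graph_at v : #|edges_at (cycle_graph c) v| = 2.
Proof.
pose u := finv (class_next c) v.
have nu : class_next c u = v by apply: f_finv.
suff -> : edges_at (cycle_graph c) v = [set [set v; class_next c v]; [set u; v]].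
  rewrite cards2; suff -> : [set v; class_next c v] != [set u; v] by [].
  apply: contraTneq (next_neqs v) => eq_e.
  have : class_next c v \in [set u; v] by rewrite -eq_e set22.
  by case/set2P=> [->|->]; rewrite ?nu eqxx ?andbF.
apply/setP=> e; rewrite inE; apply/andP/set2P.
  case=> /imsetP[x _ ->] /set2P[->|def_v]; first by left.
  right; suff -> : x = u by rewrite nu.
  by apply: next_inj; rewrite nu.
by case=> ->; rewrite ?set21 ?set22; split=> //; apply/imsetP;
  [exists v | exists u; rewrite ?nu].
Qed.

End CycleGraph.

Lemma cycle_graph_regular (n : nat) (K : eqType) (c : 'I_n -> K) :
  (forall v, 3 <= #|colour_class c v|) ->
  simple_graph (cycle_graph c) && two_regular (cycle_graph c).
Proof.
move=> large; apply/andP; split.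
  by apply/forall_inP=> e /(card_cycle_graph_edge large) ->.
by apply/forallP=> v; apply/eqP; apply: card_cycle_graph_at.
Qed.

(** A common edge at v would have its other end in both classes of v. *)
Lemma cycle_graphs_maxdeg (n : nat) (K : eqType) (c d : 'I_n -> K) v :
  (forall v, 3 <= #|colour_class c v|) ->
  (forall v, 3 <= #|colour_class d v|) ->
  colour_class c v :&: colour_class d v \subset [set v] ->
  maxdeg_ge 4 (cycle_graph c :|: cycle_graph d).
Proof.
move=> large_c large_d meet; apply/existsP; exists v.
rewrite /degree -/(edges_at _ v) edges_atU cardsU !card_cycle_graph_at //.
suff -> : edges_at (cycle_graph c) v :&: edges_at (cycle_graph d) v = set0.
  by rewrite cards0.
apply/setP=> e; rewrite !inE; apply/negP=> /andP[/andP[ec ve] /andP[ed _]].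
suff /subset_leq_card : e \subset [set v].
  by rewrite cards1 (card_cycle_graph_edge large_c ec).
apply: subset_trans meet; rewrite subsetI.
by rewrite (cycle_graph_edge_sub ec ve) (cycle_graph_edge_sub ed ve).
Qed.

(** * The lower bound *)

(** Used to hand a triple of unused vertices to each marked vertex. *)
Lemma exists_fibres_of_three (V : finType) (U W : {set V}) :
  #|U| = 3 * #|W| ->
  exists f : V -> V, (forall u, u \in U -> f u \in W) /\
    (forall w, w \in W -> #|[set u in U | f u == w]| = 3).
Proof.
elim: {W}_.+1 {-2}W (ltnSn #|W|) U => // m IH W ltWm U cU.
have [W0|[w wW]] := set_0Vmem W.
  move: cU; rewrite W0 cards0 muln0 => /cards0_eq ->.
  by exists id; split=> w; rewrite inE.
have cW := cardsD1 w W; rewrite wW in cW.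
have [X] : exists X : {set V}, (X \subset U) && (#|X| == 3).
  have : 0 < #|[set X : {set V} | X \subset U & #|X| == 3]|.
    by rewrite cards_draws bin_gt0; lia.
  by case/card_gt0P=> X; rewrite inE; exists X.
case/andP=> XU /eqP cX.
have [||f [fW fib]] := IH (W :\ w) _ (U :\: X); first by lia.
  by rewrite cardsD (setIidPr XU) cX; lia.
exists (fun u => if u \in X then w else f u); split=> [u uU|w' w'W].
  case: ifP => // nuX; have : f u \in W :\ w by apply: fW; rewrite inE nuX.
  by case/setD1P.
have [->|nw] := eqVneq w' w.
  rewrite -cX; apply: eq_card => u; rewrite !inE.
  have [uX|nuX] := boolP (u \in X); first by rewrite (subsetP XU) ?eqxx.
  apply/negP=> /andP[uU /eqP fu].
  by have := fW u; rewrite !inE nuX uU fu eqxx => /(_ isT).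
rewrite -(fib w') ?inE ?nw //; apply: eq_card => u; rewrite !inE.
by have [uX|nuX] := boolP (u \in X); rewrite //= eq_sym (negPf nw) andbF.
Qed.

(** The colour classes of c are the triples of F and, for each marked vertex w
    (a vertex outside S), w together with three vertices of S not covered by
    F. *)
Definition extends_packing (V : finType) (S : {set V}) (F : {set {set V}})
    (c : V -> {set V}) : Prop :=
  [/\ forall T v, T \in F -> v \in T -> colour_class c v = T,
      forall w, w \notin S -> exists A : {set V},
        [/\ A \subset S :\: cover F, #|A| = 3 & colour_class c w = w |: A] &
      forall u, u \in S :\: cover F ->
        exists2 w, w \notin S & u \in colour_class c w].

Lemma exists_extension (V : finType) (S : {set V}) (k : nat) (F : {set {set V}}) :
  #|S| = 3 * (k + #|~: S|) -> F \in packings id (triples V) S k ->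
  exists c, extends_packing S F c.
Proof.
move=> cS packF; have /packingsP[/subsetP tripF cF sFS dF] := packF.
have trivF : trivIset F by apply/trivIsetP=> T T'; apply: dF.
have sub_cover : cover F \subset S.
  by apply/subsetP=> v /bigcupP[T TF vT]; apply: (subsetP (sFS T TF)).
have card3 T : T \in F -> #|T| = 3 by move/tripF; rewrite inE => /eqP.
have ccF : #|cover F| = 3 * k.
  have -> : #|cover F| = \sum_(T in F) #|T| := card_packing_cover packF.
  by rewrite (eq_bigr (fun=> 3)) // sum_nat_const cF mulnC.
have [|f [fW fib]] := @exists_fibres_of_three V (S :\: cover F) (~: S).
  by rewrite cardsD (setIidPr sub_cover) ccF; lia.
pose g v := if v \in S then f v else v.
(* A vertex of a triple T gets the colour T, and a marked vertex w gets [set w],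
   as do the three vertices attached to it; the cardinals 3 and 1 keep the two
   kinds of colours apart. *)
pose c v := if v \in cover F then pblock F v else [set g v].
have pblock3 v : v \in cover F -> #|pblock F v| = 3.
  by move=> vF; apply: card3; rewrite pblock_mem.
have cN v : v \notin cover F -> c v = [set g v] by rewrite /c => /negPf ->.
have gN v : v \notin S -> g v = v by rewrite /g => /negPf ->.
have gS v : v \in S -> g v = f v by rewrite /g => ->.
have nS_F w : w \notin S -> w \notin cover F by apply: contra; apply: subsetP.
exists c; split.
- move=> T v TF vT; have vF : v \in cover F by apply/bigcupP; exists T.
  apply/setP=> u; rewrite inE /c vF (def_pblock trivF TF vT).
  case: ifP => [uF|nuF].
    apply/eqP/idP=> [<-|uT]; first by rewrite mem_pblock.
    exact: def_pblock TF uT.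
  have -> : (u \in T) = false.
    by apply: contraFF nuF => uT; apply/bigcupP; exists T.
  by apply/eqP=> /(congr1 (fun X : {set V} => #|X|)); rewrite cards1 card3.
- move=> w nwS; exists [set u in S :\: cover F | f u == w]; split.
  + by apply/subsetP=> u; rewrite inE => /andP[].
  + by rewrite fib // inE.
  + apply/setP=> u; rewrite !inE (cN w (nS_F w nwS)) gN // /c.
    case: ifP => [uF|/negbT nuF].
      rewrite (_ : (u == w) = false); last first.
        by apply: contraNF (nS_F w nwS) => /eqP <-.
      by apply/eqP=> /(congr1 (fun X : {set V} => #|X|)); rewrite cards1 pblock3.
    rewrite (inj_eq set1_inj); have [uS|nuS] := boolP (u \in S).
      by rewrite gS // (_ : (u == w) = false) //; apply: contraNF nwS => /eqP <-.
    by rewrite gN // andbF /= orbF.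
- move=> u uU; have := uU; rewrite inE => /andP[nuF uS].
  exists (f u); first by have := fW u uU; rewrite inE.
  have nfS : f u \notin S by have := fW u uU; rewrite inE.
  by rewrite inE (cN u nuF) (cN _ (nS_F _ nfS)) (gS u uS) (gN _ nfS).
Qed.

Lemma extension_large (V : finType) (S : {set V}) (k : nat) (F : {set {set V}})
    (c : V -> {set V}) v :
  F \in packings id (triples V) S k -> extends_packing S F c -> 3 <= #|colour_class c v|.
Proof.
case/packingsP=> /subsetP tripF _ sFS _ [cT cW cU].
have out w : w \notin S -> 3 <= #|colour_class c w|.
  by case/cW=> A [_ cA ->]; rewrite -cA; apply/subset_leq_card/subsetUr.
have [vS|] := boolP (v \in S); last exact: out.
have [/bigcupP[T TF vT]|nvF] := boolP (v \in cover F).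
  by rewrite (cT T v TF vT); have := tripF T TF; rewrite inE => /eqP ->.
have [|w nwS vw] := cU v; first by rewrite inE nvF.
move: (out w nwS); rewrite inE in vw; congr (_ <= #|pred_of_set _|).
by apply/setP=> u; rewrite !inE (eqP vw).
Qed.

(** Here B sends a vertex to its class for an equivalence relation. Three
    elements cannot be split into classes of size at least 2. *)
Lemma triple_sub_block (V : finType) (T : {set V}) v : #|T| = 3 -> v \in T ->
  forall B : V -> {set V}, (forall u, u \in B u) ->
  (forall u w, u \in B w -> B u = B w) ->
  (forall u, u \in T -> ~~ (T :&: B u \subset [set u])) -> T \subset B v.
Proof.
move=> cT vT B Bid Beq paired.
have partner u : u \in T -> exists2 w, w \in T & (w != u) && (w \in B u).
  by move/paired/subsetPn=> [w /setIP[wT wB]]; rewrite inE; exists w => //; apply/andP.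
have [u uT /andP[nuv uBv]] := partner v vT.
apply/subsetP=> y yT; have [-> //|nyv] := eqVneq y v.
have [-> //|nyu] := eqVneq y u.
have [z zT /andP[nzy zBy]] := partner y yT.
have defT : T = [set v; u; y].
  apply/esym/eqP; rewrite eqEcard !subUset !sub1set vT uT yT cT.
  by rewrite -setUA cardsU1 cards2 !inE !(eq_sym v) (negPf nuv) (negPf nyv) eq_sym nyu.
rewrite defT !inE (negPf nzy) orbF in zT; case/orP: zT => /eqP def_z.
  by rewrite -def_z (Beq _ _ zBy).
by rewrite -(Beq _ _ uBv) -def_z (Beq _ _ zBy).
Qed.

(** Take T in F1 but not in F2. If c2 isolates no vertex of T inside T, then T
    lies in a class of c2, which cannot be a triple of F2; so T is the triple
    attached by c2 to some marked w. The class of w for c1 is disjoint from T,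
    because it uses only vertices not covered by F1. *)
Lemma extensions_separated (V : finType) (S : {set V}) (k : nat)
    (F1 F2 : {set {set V}}) (c1 c2 : V -> {set V}) :
  F1 \in packings id (triples V) S k -> F2 \in packings id (triples V) S k ->
  extends_packing S F1 c1 -> extends_packing S F2 c2 -> F1 != F2 ->
  exists v, colour_class c1 v :&: colour_class c2 v \subset [set v].
Proof.
move=> packF1 packF2 [cT1 cW1 _] [cT2 cW2 cU2] neqF.
have /packingsP[/subsetP trip1 cF1 sS1 _] := packF1.
have /packingsP[/subsetP trip2 cF2 _ _] := packF2.
have card3_1 T : T \in F1 -> #|T| = 3 by move/trip1; rewrite inE => /eqP.
have card3_2 T : T \in F2 -> #|T| = 3 by move/trip2; rewrite inE => /eqP.
have /subsetPn[T TF1 nTF2] : ~~ (F1 \subset F2).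
  by apply: contraNN neqF => sF; rewrite eqEcard sF cF1 cF2 leqnn.
have [/exists_inP[v vT meet]|] :=
  boolP [exists v in T, T :&: colour_class c2 v \subset [set v]].
  by exists v; rewrite (cT1 T v TF1 vT).
rewrite negb_exists_in => /forall_inP paired.
have [v vT] : exists v, v \in T by apply/set0Pn; rewrite -cards_eq0 card3_1.
have sTc : T \subset colour_class c2 v.
  apply: triple_sub_block paired => //; first exact: card3_1.
    by move=> u; rewrite inE.
  by move=> u w; rewrite inE => /eqP cu; apply/setP=> x; rewrite !inE cu.
have vS : v \in S := subsetP (sS1 T TF1) v vT.
have nvF2 : v \notin cover F2.
  apply: contra nTF2 => /bigcupP[T2 T2F vT2]; move: sTc; rewrite (cT2 T2 v) //.
  by move=> sT; have -> // : T = T2; apply/eqP; rewrite eqEcard sT (card3_1 T TF1) (card3_2 T2 T2F).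
have [|w nwS] := cU2 v; first by rewrite inE nvF2.
have [A2 [_ cA2 cw2]] := cW2 w nwS; have [A1 [sA1 _ cw1]] := cW1 w nwS.
rewrite inE => /eqP cv.
have defA2 : A2 = T.
  apply/esym/eqP; rewrite eqEcard cA2 card3_1 // andbT.
  apply/subsetP=> u uT; have := subsetP sTc u uT; rewrite inE cv => cu.
  have : u \in colour_class c2 w by rewrite inE.
  rewrite cw2 => /setU1P[eq_uw|//].
  by move: nwS; rewrite -eq_uw (subsetP (sS1 T TF1)).
exists w; rewrite cw1 cw2 defA2; apply/subsetP=> u; rewrite !inE.
have [//|_ /=] := eqVneq u w => /andP[uA1 uT].
have := subsetP sA1 u uA1; rewrite inE => /andP[/negP[]].
by apply/bigcupP; exists T.
Qed.

Lemma admissible_leq (n : nat) (G : {set {set {set 'I_n}}}) :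
  admissible G -> #|G| <= max_family n.
Proof. by move=> admG; apply: (bigop.bigmax_sup G). Qed.

(** A single cycle through all the vertices. *)
Lemma max_family_gt0 (n : nat) : 3 <= n -> 0 < max_family n.
Proof.
move=> n3; pose E := cycle_graph (fun _ : 'I_n => tt).
have regE : simple_graph E && two_regular E.
  apply: cycle_graph_regular => v; suff -> : colour_class (fun _ : 'I_n => tt) v = setT.
    by rewrite cardsT card_ord.
  by apply/setP=> u; rewrite !inE.
rewrite -(cards1 E); apply: admissible_leq; apply/andP; split.
  by apply/forall_inP=> F /set1P ->.
by apply/forall_inP=> F /set1P ->; apply/forall_inP=> F' /set1P ->; rewrite eqxx.
Qed.

(** The number of vertices in S is such that a packing of k triples leaves
    exactly three vertices for each marked vertex. *)
Lemma packings_leq_max_family (n k : nat) (S : {set 'I_n}) :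
  #|S| = 3 * (k + #|~: S|) ->
  #|packings id (triples 'I_n) S k| <= max_family n.
Proof.
move=> cS.
have /fin_all_exists[c refC] : forall F : {set {set 'I_n}},
    exists c : 'I_n -> {set 'I_n},
      F \in packings id (triples 'I_n) S k -> extends_packing S F c.
  move=> F; have [packF|_] := boolP (F \in packings id (triples 'I_n) S k).
    by have [c refC] := exists_extension cS packF; exists c.
  by exists (fun=> set0).
pose graph F := cycle_graph (c F).
have large F v : F \in packings id (triples 'I_n) S k ->
    3 <= #|colour_class (c F) v|.
  by move=> packF; apply: extension_large packF (refC F packF).
have doubled F1 F2 : F1 \in packings id (triples 'I_n) S k ->
    F2 \in packings id (triples 'I_n) S k -> F1 != F2 ->
    maxdeg_ge 4 (graph F1 :|: graph F2).
  move=> pF1 pF2 neqF.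
  have [v meet] := extensions_separated pF1 pF2 (refC _ pF1) (refC _ pF2) neqF.
  by apply: cycle_graphs_maxdeg meet => u; apply: large.
have reg F : F \in packings id (triples 'I_n) S k ->
    simple_graph (graph F) && two_regular (graph F).
  by move=> pF; apply: cycle_graph_regular => v; apply: large.
have inj_graph : {in packings id (triples 'I_n) S k &, injective graph}.
  move=> F1 F2 pF1 pF2 eq_graph; apply/eqP; apply: contraT => neqF.
  have /existsP[v] := doubled F1 F2 pF1 pF2 neqF; rewrite eq_graph setUid.
  by have /andP[_ /forallP/(_ v)/eqP ->] := reg F2 pF2.
rewrite -(card_in_imset inj_graph); apply: admissible_leq; apply/andP; split.
  by apply/forall_inP=> _ /imsetP[F pF ->]; apply: reg.
apply/forall_inP=> _ /imsetP[F1 pF1 ->]; apply/forall_inP=> _ /imsetP[F2 pF2 ->].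
by apply/implyP=> neq; apply: doubled => //; apply: contra neq => /eqP ->.
Qed.

Lemma fact_leq_packings (k r : nat) :
  (3 * (k + r))`! <= max_family (3 * (k + r) + r) * (k`! * 6 ^ k * (3 * r)`!).
Proof.
pose n := 3 * (k + r) + r; rewrite -/n; pose S := [set v : 'I_n | v < 3 * (k + r)].
have cS : #|S| = 3 * (k + r).
  have le_n : 3 * (k + r) <= n by apply: leq_addr.
  have inj_w : injective (widen_ord le_n) by move=> i j /(congr1 val)/= /val_inj.
  rewrite -[RHS]card_ord -cardsT -(card_imset _ inj_w).
  apply: eq_card => v; rewrite inE; apply/idP/imsetP => [vlt|[i _ ->]]; last first.
    exact: (ltn_ord i).
  by exists (Ordinal vlt) => //; apply: val_inj.
have cSC : #|~: S| = r by have := cardsC S; rewrite cS card_ord /n; lia.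
have := @packings_leq_max_family n k S; rewrite cS cSC => /(_ erefl) le_max.
have le_k : 3 * k <= #|S| by rewrite cS; lia.
have := card_triple_packings le_k; rewrite cS (_ : _ - 3 * k = 3 * r); last by lia.
by move=> <-; rewrite leq_mul2r le_max orbT.
Qed.

Lemma max_family_lower3 (m : nat) :
  (3 * m)`! <= max_family (3 * m) * (m`! * 6 ^ m).
Proof. by have := fact_leq_packings m 0; rewrite muln0 !addn0 muln1. Qed.

(** For n = 3m + 1 the loss is the factor (3m+1)/m <= 4. For n = 3m + 2 it is
    20 (3m+1)(3m+2) / (m(m-1)), where 20 = 6!/6^2; this decreases in m >= 2 and
    equals 20 * 28 = 560 at m = 2. The remaining case n = 5, where there is not
    one triple for each of the two marked vertices, needs only R(5) > 0. *)
Lemma max_family_lower (n : nat) : 3 <= n ->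
  n`! <= 560 * max_family n * ((n %/ 3)`! * 6 ^ (n %/ 3)).
Proof.
have := divn_eq n 3; have : n %% 3 < 3 by rewrite ltn_mod.
move: (n %/ 3) (n %% 3) => m [|[|[|//]]] _ -> n3.
- rewrite addn0 mulnC; have := max_family_lower3 m; lia.
- case: m n3 => // k _; have := fact_leq_packings k 1.
  rewrite !addn1 mulnC muln1 (_ : 3`! = 6) // !factS expnS; nia.
- case: m n3 => // [[|k]] _.
    have := @max_family_gt0 (3 + 2) isT.
    rewrite mul1n (_ : (3 + 2)`! = 120) // (_ : 1`! * 6 ^ 1 = 6) //; lia.
  have := fact_leq_packings k 2; rewrite !addn2 (mulnC k.+2).
  rewrite (_ : (3 * 2)`! = 720) // ![k.+2`!]factS ![k.+1`!]factS !expnS.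
  rewrite ![(3 * k.+2).+2`!]factS ![(3 * k.+2).+1`!]factS.
  set N := (_`! in X in X <= _); nia.
Qed.

(** * Passage to the real numbers *)

Local Open Scope ring_scope.

(** Keep the constant and quadratic terms of the exponential series. *)
Lemma expR_sqrt_ge (R : realType) (n : nat) :
  (n./2).+1%:R <= expR (Num.sqrt (n%:R : R)).
Proof.
apply: le_trans (expR_ge1Dxn 1 (sqrtr_ge0 n%:R)).
rewrite sqr_sqrtr ?ler0n // -natr1 addrC lerD2l ler_pdivlMr ?ltr0n //.
rewrite -natrM ler_nat (_ : 2`! = 2)%N //; lia.
Qed.

Lemma powR_third_ge (R : realType) (n : nat) :
  (6 ^ (n %/ 3))%:R <= (6 : R) `^ (n%:R / 3).
Proof.
rewrite natrX -powR_mulrn ?ler0n //; apply: ler_powR; first by rewrite ler1n.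
by rewrite ler_pdivlMr ?ltr0n // -natrM ler_nat leq_trunc_div.
Qed.

Unset Implicit Arguments.

Theorem theorem2 (R : realType) :
  (exists c : R, 0 < c /\
     forall n : nat, (3 <= n)%N ->
       c * ((n`!)%:R / (((n %/ 3)`!)%:R * 6 `^ (n%:R / 3)))
         <= (max_family n)%:R
       /\ (max_family n)%:R
         <= expR (Num.sqrt (n%:R : R)) * ((n`!)%:R / ((n %/ 3)`!)%:R))
  /\ (forall n : nat, (3 <= n)%N -> (3 %| n)%N ->
       (n`!)%:R / (((n %/ 3)`!)%:R * 6 `^ (n%:R / 3))
         <= ((max_family n)%:R : R)).
Proof.
have fact_pos k : 0 < k`!%:R :> R by rewrite ltr0n fact_gt0.
have den_pos n : 0 < (n %/ 3)`!%:R * 6 `^ (n%:R / 3) :> R.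
  by apply: mulr_gt0 => //; rewrite powR_gt0 ?ltr0n.
have le_den n : ((n %/ 3)`! * 6 ^ (n %/ 3))%:R
    <= (n %/ 3)`!%:R * 6 `^ (n%:R / 3) :> R.
  by rewrite natrM ler_wpM2l ?powR_third_ge ?ler0n.
split; last first.
  move=> n _ /divnK def_n; rewrite ler_pdivrMr //.
  apply: le_trans (ler_wpM2l _ (le_den n)); rewrite ?ler0n // -natrM ler_nat.
  by have := max_family_lower3 (n %/ 3); rewrite mulnC def_n.
exists 560^-1; split; first by rewrite invr_gt0 ltr0n.
move=> n n3; split.
  rewrite mulrC ler_pdivrMr ?ltr0n // ler_pdivrMr //.
  apply: le_trans (ler_wpM2l _ (le_den n)); rewrite ?mulr_ge0 ?ler0n //.
  by rewrite -!natrM ler_nat [X in (X * _)%N]mulnC max_family_lower.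
rewrite mulrA ler_pdivlMr // mulrC.
apply: (@le_trans _ _ ((n./2).+1%:R * n`!%:R)).
  by rewrite -!natrM ler_nat max_family_upper.
by rewrite ler_wpM2r ?ler0n ?expR_sqrt_ge.
Qed.
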